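(* Let $U,\hat U$ be Hilbert spaces, $Q:U\to\hat U$ a bounded linear operator such that $\gamma(Q)>0$, $w\in\hat U$, $u^{(0)}\in U$. Let $(\alpha_n)_{n\ge0}$ be a real sequence, let $(u^{(n)})_{n\ge0}$ satisfy $$u^{(n+1)}=u^{(n)}-\alpha_n\,Q^*(Qu^{(n)}-w),\qquad n\ge0,$$ and let $e^{(n)}:=u^{(n)}-P_{M_{Q,w}}u^{(0)}$ for all $n\ge0$. Put $\lambda_n:=\alpha_n\|Q\|^2/2$. (i) If $\lambda_n\in[0,1]$ for all $n\ge0$ and $\liminf_{n\to\infty}\frac1n\sum_{j=0}^{n-1}\min(\lambda_j,1-\lambda_j)>0$, then $e^{(n)}$ converges linearly to zero. (ii) If moreover, for some $\epsilon\in(0,1]$, $\lambda_n\in[\frac\epsilon2,1-\frac\epsilon2]$ for all $n\ge0$, then $$\|e^{(n)}\|\le(1-\epsilon/\kappa^2)^n\,\|e^{(0)}\|,\qquad n\ge0,$$ where $\kappa:=\|Q\|/\gamma(Q)$.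
   Context: $Q^*$ is the adjoint of $Q$. $M_{Q,w}:=\{u\in U:\|Qu-w\|=\inf_{v\in U}\|Qv-w\|\}$, which is nonempty for every $w$ when $\gamma(Q)>0$; $P_S$ is the orthogonal projection onto a nonempty closed affine subspace $S$. The reduced minimum modulus of $Q$ is $\gamma(Q):=\inf\{\|Qu\|:u\in(\ker Q)^\perp,\ \|u\|=1\}$; $\gamma(Q)>0$ is equivalent to $\operatorname{ran}(Q)$ being closed. ''Converges linearly to zero'' means that there are $C\ge0$ and $q\in(0,1)$ with $\|e^{(n)}\|\le Cq^n$ for all $n\ge0$. *)

(* Defs.v *)
From HB Require Import structures.
From mathcomp Require Import all_boot all_order all_algebra complex.
From mathcomp Require Import all_classical all_reals all_analysis.
Import Order.TTheory GRing.Theory Num.Theory numFieldNormedType.Exports.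

Set Implicit Arguments.
Unset Strict Implicit.
Unset Printing Implicit Defensive.

Local Open Scope classical_set_scope.
Local Open Scope ring_scope.

(* Hilbert spaces are taken over a field of scalars that is either the real
   numbers R or the complex numbers R[i]; both cases are handled at once. *)
Variant scalar_kind := RealScalars | ComplexScalars.

Definition scalar_field (R : realType) (k : scalar_kind) : numFieldType :=
  match k with
  | RealScalars => R
  | ComplexScalars => R[i]%C
  end.

Definition sconj (R : realType) (k : scalar_kind) :
    scalar_field R k -> scalar_field R k :=
  match k return scalar_field R k -> scalar_field R k with
  | RealScalars => id
  | ComplexScalars => @conjc R
  end.

Definition sre (R : realType) (k : scalar_kind) : scalar_field R k -> R :=
  match k return scalar_field R k -> R with
  | RealScalars => id
  | ComplexScalars => @complex.Re R
  end.

Definition of_real (R : realType) (k : scalar_kind) : R -> scalar_field R k :=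
  match k return R -> scalar_field R k with
  | RealScalars => id
  | ComplexScalars => fun x => Complex x 0
  end.
Arguments of_real {R k}.

HB.mixin Record hasInnerProduct (R : realType) (k : scalar_kind) (U : Type)
    of NormedModule (scalar_field R k) U := {
  inner : U -> U -> scalar_field R k ;
  innerPl : forall (a : scalar_field R k) (u v w : U),
    inner (a *: u + v) w = a * inner u w + inner v w ;
  innerC : forall u v : U, inner u v = sconj (inner v u) ;
  inner_norm : forall u : U, inner u u = `|u| ^+ 2
}.

#[short(type="hilbertType")]
HB.structure Definition Hilbert (R : realType) (k : scalar_kind) :=
  {U of CompleteNormedModule (scalar_field R k) U & hasInnerProduct R k U}.

(* MathComp-Analysis norms take their values in the field of scalars (as
   nonnegative elements of R[i] in the complex case); this is the same norm as
   a real number. *)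
Definition hnorm (R : realType) (k : scalar_kind) (U : hilbertType R k)
  (u : U) : R := sre `|u|.

Definition orthocomplement (R : realType) (k : scalar_kind)
    (U : hilbertType R k) (A : set U) : set U :=
  [set u | forall v, A v -> inner u v = 0].

Definition orthoproj (R : realType) (k : scalar_kind) (U : hilbertType R k)
    (S : set U) (x : U) : U :=
  xget 0 [set p | S p /\ forall v, S v -> inner (x - p) (v - p) = 0].

Section Operators.
Variables (R : realType) (k : scalar_kind) (U V : hilbertType R k).
Implicit Type Q : {linear U -> V}.

Definition bounded_operator Q : Prop :=
  exists M : R, forall u, hnorm (Q u) <= M * hnorm u.

Definition opnorm Q : R := sup [set hnorm (Q u) | u in [set u | hnorm u <= 1]].

Definition adjoint Q (v : V) : U :=
  xget 0 [set a | forall u, inner (Q u) v = inner u a].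

Definition kernel Q : set U := [set u | Q u = 0].

(* The infimum is taken in the extended reals, so it is +oo when Q = 0. *)
Definition reduced_min_modulus Q : \bar R :=
  ereal_inf [set (hnorm (Q u))%:E |
    u in [set u | orthocomplement (kernel Q) u /\ hnorm u = 1]].

Definition least_squares_solutions Q (w : V) : set U :=
  [set u | hnorm (Q u - w) = inf [set hnorm (Q v - w) | v in setT]].

End Operators.

Definition converges_linearly_to_zero (R : realType) (k : scalar_kind)
    (U : hilbertType R k) (e : nat -> U) : Prop :=
  exists C q : R, [/\ 0 <= C, 0 < q, q < 1 &
    forall n, hnorm (e n) <= C * q ^+ n].

(* Main.v *)
(* Write N = ker Q. The projection p of u_0 onto the least squares set satisfies
   Q^*(Qp - w) = 0, so e_{n+1} = (1 - alpha_n Q^*Q) e_n, and e_0, hence every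
   e_n, lies in the orthogonal complement of N. There
   gamma^2 |x|^2 <= <Q^*Qx, x> = |Qx|^2 <= ||Q||^2 |x|^2,
   so the symmetric operator 1 - alpha_n Q^*Q has norm at most
   1 - 2 min(lambda_n, 1 - lambda_n) / kappa^2. Both rates follow by taking
   products, using 1 - t <= exp(-t) for the first one.

   Adjoints (Riesz), orthogonal projections and least squares solutions all come
   from one fact: a continuous functional that is bounded below and uniformly
   convex in the sense of the parallelogram identity attains its minimum on a
   closed midpoint-convex set. Real and complex scalars are treated together
   through the real inner product Re <u, v>; for subspaces that are stable under
   all scalars it gives the same orthogonality relation. *)
Require Import Defs.
From HB Require Import structures.
From mathcomp Require Import all_boot all_order all_algebra complex.
From mathcomp Require Import all_classical all_reals all_analysis.
From mathcomp Require Import ring lra.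

Set Implicit Arguments.
Unset Strict Implicit.
Unset Printing Implicit Defensive.

Import Order.TTheory GRing.Theory Num.Theory numFieldNormedType.Exports.

Local Open Scope classical_set_scope.
Local Open Scope ring_scope.

(** * Real parts and embedded reals, uniformly over both scalar fields *)

Section Scalars.
Variables (R : realType) (k : scalar_kind).
Local Notation K := (scalar_field R k).
Implicit Types z : K.

Lemma sreD z1 z2 : sre (z1 + z2) = sre z1 + sre z2.
Proof. by case: k z1 z2 => //= - [a b] [c d]. Qed.

Lemma sreB z1 z2 : sre (z1 - z2) = sre z1 - sre z2.
Proof. by case: k z1 z2 => //= - [a b] [c d]. Qed.

Lemma sreM_real (a : R) z : sre (of_real a * z) = a * sre z.
Proof. by case: k z => //= - [b c] /=; rewrite mul0r subr0. Qed.

Lemma sre_conj z : sre (sconj z) = sre z.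
Proof. by case: k z => //= - []. Qed.

Lemma sconj0 : sconj (0 : K) = 0.
Proof. by case: k => //=; apply/eqP; rewrite eq_complex /= oppr0 !eqxx. Qed.

Lemma sre_real (a : R) : sre (of_real a : K) = a.
Proof. by case: k. Qed.

Lemma ge0_sreK z : 0 <= z -> of_real (sre z) = z.
Proof. by case: k z => //= - [a b]; rewrite lecE /= => /andP[/eqP->]. Qed.

Lemma of_real_le (a b : R) : (of_real a <= of_real b :> K) = (a <= b).
Proof. by case: k => //=; rewrite lecE /= eqxx. Qed.

Lemma of_real_lt (a b : R) : (of_real a < of_real b :> K) = (a < b).
Proof. by case: k => //=; rewrite ltcE /= eqxx. Qed.

Lemma of_real0 : of_real (0 : R) = 0 :> K.
Proof. by case: k. Qed.

Lemma of_realD (a b : R) : of_real (a + b) = of_real a + of_real b :> K.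
Proof. by case: k => //=; apply/eqP; rewrite eq_complex /= addr0 !eqxx. Qed.

Lemma of_realM (a b : R) : of_real (a * b) = of_real a * of_real b :> K.
Proof.
by case: k => //=; apply/eqP; rewrite eq_complex /= !(mul0r, mulr0, addr0, subr0) !eqxx.
Qed.

Lemma norm_of_real (a : R) : `|of_real a : K| = of_real `|a|.
Proof.
by case: k => //=; rewrite normc_def /= expr0n addr0 sqrtr_sqr.
Qed.

(** The scalars 1 and i already detect both parts of [z]. This lifts identities for the real inner
    product to identities for [inner]. *)
Lemma sreM_eq0 z : (forall c : K, sre (c * z) = 0) -> z = 0.
Proof.
case: k z => /= [z /(_ 1)|[a b] zP]; first by rewrite mul1r.
have /= := zP 1%C; have /= := zP (Complex 0 1).
by rewrite !(mul0r, mul1r, subr0, sub0r) => /eqP; rewrite oppr_eq0 => /eqP -> ->.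
Qed.

End Scalars.

(** * The real inner product Re <u, v> and the real-valued norm *)

Section RealInnerProduct.
Variables (R : realType) (k : scalar_kind) (U : hilbertType R k).
Local Notation K := (scalar_field R k).
Implicit Types (u v x y : U) (a b : R).

Definition rinner u v : R := sre (inner u v).

Lemma rinnerC u v : rinner u v = rinner v u.
Proof. by rewrite /rinner innerC sre_conj. Qed.

Lemma rinnerPl a u v x : rinner (of_real a *: u + v) x = a * rinner u x + rinner v x.
Proof. by rewrite /rinner innerPl sreD sreM_real. Qed.

Lemma rinnerDl u v x : rinner (u + v) x = rinner u x + rinner v x.
Proof.
have := rinnerPl 1 u v x; rewrite mul1r => <-; congr rinner; congr (_ + _).
by rewrite -[LHS]scale1r; congr (_ *: _); case: (k).
Qed.

Lemma rinner0l x : rinner 0 x = 0.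
Proof. by apply: (@addrI _ (rinner 0 x)); rewrite -rinnerDl !addr0. Qed.

Lemma rinnerZl a u x : rinner (of_real a *: u) x = a * rinner u x.
Proof. by rewrite -[_ *: _]addr0 rinnerPl rinner0l addr0. Qed.

Lemma rinnerNl u x : rinner (- u) x = - rinner u x.
Proof. by apply/eqP; rewrite -addr_eq0 -rinnerDl addNr rinner0l. Qed.

Lemma rinnerBl u v x : rinner (u - v) x = rinner u x - rinner v x.
Proof. by rewrite rinnerDl rinnerNl. Qed.

Lemma rinnerDr u v x : rinner x (u + v) = rinner x u + rinner x v.
Proof. by rewrite rinnerC rinnerDl !(rinnerC x). Qed.

Lemma rinner0r x : rinner x 0 = 0.
Proof. by rewrite rinnerC rinner0l. Qed.

Lemma rinnerZr a u x : rinner x (of_real a *: u) = a * rinner x u.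
Proof. by rewrite rinnerC rinnerZl rinnerC. Qed.

Lemma rinnerNr u x : rinner x (- u) = - rinner x u.
Proof. by rewrite rinnerC rinnerNl rinnerC. Qed.

Lemma rinnerBr u v x : rinner x (u - v) = rinner x u - rinner x v.
Proof. by rewrite rinnerDr rinnerNr. Qed.

Definition rinnerE := (rinnerDl, rinnerDr, rinnerNl, rinnerNr, rinnerZl, rinnerZr).

Lemma normE u : `|u| = of_real (hnorm u).
Proof. by rewrite /hnorm ge0_sreK. Qed.

Lemma hnorm_ge0 u : 0 <= hnorm u.
Proof. by rewrite -(@of_real_le _ k) -normE of_real0. Qed.

Lemma rinnervv u : rinner u u = hnorm u ^+ 2.
Proof. by rewrite /rinner inner_norm normE !expr2 sreM_real sre_real. Qed.

Lemma hnorm0 : hnorm (0 : U) = 0.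
Proof. by rewrite /hnorm normr0 -of_real0 sre_real. Qed.

Lemma hnorm_eq0 u : hnorm u = 0 -> u = 0.
Proof. by move=> u0; apply/eqP; rewrite -normr_eq0 normE u0 of_real0. Qed.

Lemma hnormZ a u : hnorm (of_real a *: u) = `|a| * hnorm u.
Proof. by rewrite /hnorm normrZ norm_of_real sreM_real. Qed.

Lemma hnormN u : hnorm (- u) = hnorm u.
Proof. by rewrite /hnorm normrN. Qed.

Lemma hnormBC u v : hnorm (u - v) = hnorm (v - u).
Proof. by rewrite -hnormN opprB. Qed.

Lemma hnormD u v : hnorm (u + v) <= hnorm u + hnorm v.
Proof. by rewrite -(@of_real_le _ k) of_realD -!normE ler_normD. Qed.

Lemma ler_rinner u v : `|rinner u v| <= hnorm u * hnorm v.
Proof.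
have [u0|un0] := eqVneq (hnorm u) 0.
  by rewrite (hnorm_eq0 u0) rinner0l hnorm0 mul0r normr0.
(* Cauchy-Schwarz without division: [x] is |u|^2 times the component of [v] orthogonal to [u], and
   |x|^2 = |u|^2 (|u|^2 |v|^2 - [rinner u v]^2). *)
set x := of_real (hnorm u ^+ 2) *: v - of_real (rinner u v) *: u.
have := sqr_ge0 (hnorm x); rewrite -(rinnervv x) !rinnerE !rinnervv (rinnerC v u).
set n := hnorm u in un0 *; set m := hnorm v; set i := rinner u v => h.
rewrite -(@ler_pXn2r _ 2) ?nnegrE ?mulr_ge0 ?hnorm_ge0//.
rewrite real_normK ?num_real// -subr_ge0.
have n2 : 0 < n ^+ 2 by rewrite exprn_even_gt0.
rewrite -(pmulr_rge0 _ n2); apply: le_trans h _.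
by rewrite le_eqVlt; apply/orP; left; apply/eqP; ring.
Qed.

Lemma innerZl (c : K) u v : inner (c *: u) v = c * inner u v.
Proof.
have inner0 : inner 0 v = 0.
  apply: (@addrI _ (inner 0 v)); rewrite addr0.
  by have := innerPl 1 0 0 v; rewrite scaler0 addr0 mul1r.
by have := innerPl c u 0 v; rewrite !addr0 inner0 addr0.
Qed.

Lemma inner_eq0 u v : (forall c : K, rinner (c *: u) v = 0) -> inner u v = 0.
Proof. by move=> h; apply: sreM_eq0 => c; rewrite -innerZl; exact: h. Qed.

(** Completeness transported to [hnorm]: radii of balls live in the scalar field, but a positive one
    is the image of its real part. *)
Lemma hilbert_complete (x : nat -> U) :
  (forall e : R, 0 < e -> exists N, forall m n, (N <= m)%N -> (N <= n)%N ->
     hnorm (x m - x n) < e) ->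
  exists l, hnorm (x n - l) @[n --> \oo] --> (0 : R).
Proof.
move=> xC.
have /cauchy_cvg/cvg_ex[l xl] : cauchy (x @ \oo).
  apply/cauchy_ballP => e e0.
  have eE : of_real (sre e) = e by rewrite ge0_sreK// ltW.
  have e'0 : 0 < sre e by rewrite -(@of_real_lt _ k) eE of_real0.
  have [N NP] := xC _ e'0.
  pose X := [set x n | n in [set n | (N <= n)%N]]; exists (X, X) => /=.
    by split; exists N => // n /= Nn; exists n.
  move=> [_ _] [] /= [m Nm <-] [n Nn <-].
  by rewrite -ball_normE /= normE -eE of_real_lt NP.
exists l; apply/cvgrPdist_lt => e e0.
have e'0 : 0 < of_real e :> K by rewrite -of_real0 of_real_lt.
have /cvgrPdist_lt /(_ _ e'0) := xl.
apply: filterS => n; rewrite normE of_real_lt.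
by rewrite sub0r normrN (ger0_norm (hnorm_ge0 _)) hnormBC.
Qed.

End RealInnerProduct.

(** * Minimization of uniformly convex functionals and orthogonal decomposition *)

Section Minimization.
Variables (R : realType) (k : scalar_kind) (U : hilbertType R k).
Implicit Types (x : nat -> U) (l u v : U) (S A : set U) (F : U -> R).

(** The first-order condition at a minimum, applied below along lines p + t h through a minimizer
    [p]. *)
Lemma linear_coef_eq0 (a b : R) : (forall t, 0 <= a * t ^+ 2 + 2 * b * t) -> b = 0.
Proof.
move=> h; have a0 : 0 <= a by have := h 1; have := h (- 1); rewrite sqrrN expr1n; lra.
have a1 : a + 1 != 0 by rewrite gt_eqF// ltr_wpDl.
(* Dividing by [a + 1] rather than [a] covers [a = 0] and still makes the value nonpositive. *)
have := h (- b / (a + 1)).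
have -> : a * (- b / (a + 1)) ^+ 2 + 2 * b * (- b / (a + 1)) =
          - ((a + 2) * (b / (a + 1)) ^+ 2) by field.
rewrite oppr_ge0 pmulr_rle0 ?ltr_wpDl// => b0.
have /eqP : (b / (a + 1)) ^+ 2 = 0 by apply/le_anti; rewrite b0 sqr_ge0.
by rewrite sqrf_eq0 mulf_eq0 invr_eq0 (negPf a1) orbF => /eqP.
Qed.

Definition hcvg x l := hnorm (x n - l) @[n --> \oo] --> (0 : R).

Lemma hcvg_rinner x l v : hcvg x l -> rinner (x n) v @[n --> \oo] --> rinner l v.
Proof.
move=> xl; apply/subr_cvg0/norm_cvg0P.
apply: (@squeeze_cvgr _ _ _ _ (fun=> 0) (fun n => hnorm (x n - l) * hnorm v)).
- by near=> n; rewrite normr_ge0 -rinnerBl ler_rinner.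
- exact: cvg_cst.
- by rewrite -(mul0r (hnorm v)); apply: cvgMl.
Unshelve. all: by end_near. Qed.

Lemma hcvg_hnorm x l : hcvg x l -> hnorm (x n) @[n --> \oo] --> hnorm l.
Proof.
move=> xl; apply/subr_cvg0/norm_cvg0P.
apply: (@squeeze_cvgr _ _ _ _ (fun=> 0) (fun n => hnorm (x n - l))) => //.
- near=> n; rewrite normr_ge0 /= ler_norml.
  have := hnormD (x n - l) l; have := hnormD (l - x n) (x n).
  by rewrite !subrK (hnormBC l) => h1 h2; apply/andP; split; lra.
- exact: cvg_cst.
Unshelve. all: by end_near. Qed.

(** A minimizing sequence is Cauchy: midpoints stay in [S], so F(midpoint) is at least the infimum
    and c |x_i - x_j|^2 is at most the sum of the two excesses over it. *)
Lemma exists_minimizer S F (m c : R) : S !=set0 ->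
  (forall x l, (forall n, S (x n)) -> hcvg x l -> S l) ->
  (forall u v, S u -> S v -> S (of_real 2^-1 *: (u + v))) ->
  (forall x l, hcvg x l -> F (x n) @[n --> \oo] --> F l) ->
  (forall u, m <= F u) -> 0 < c ->
  (forall u v, S u -> S v ->
    c * hnorm (u - v) ^+ 2 <= F u + F v - 2 * F (of_real 2^-1 *: (u + v))) ->
  exists2 p, S p & forall u, S u -> F p <= F u.
Proof.
move=> [s0 Ss0] Scl Smid Fc Fm c0 Fp.
have hi : has_inf (F @` S).
  by split; [exists (F s0), s0|exists m => _ [u _ <-]].
have infle u : S u -> inf (F @` S) <= F u.
  by move=> Su; apply: ge_inf; [case: hi|exists u].
have /choice[x xP] (n : nat) : exists u, S u /\ F u < inf (F @` S) + n.+1%:R^-1.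
  have n0 : 0 < n.+1%:R^-1 :> R by rewrite invr_gt0.
  by have [_ [u Su <-] Fu] := inf_adherent n0 hi; exists u.
have Sx n : S (x n) by case: (xP n).
have [l xl] : exists l, hcvg x l.
  apply: hilbert_complete => e e0.
  have ce0 : 0 < c * e ^+ 2 / 2 by rewrite divr_gt0 ?mulr_gt0 ?exprn_gt0.
  have [N _ NP] := near_infty_natSinv_lt (PosNum ce0).
  exists N => i j Ni Nj.
  have Fi := (xP i).2; have Fj := (xP j).2.
  have := NP i Ni; have := NP j Nj => /=.
  have := Fp _ _ (Sx i) (Sx j); have := infle _ (Smid _ _ (Sx i) (Sx j)).
  move: Fi Fj; set a := i.+1%:R^-1; set b := j.+1%:R^-1; move=> h1 h2 h3 h4 h5 h6.
  have : c * hnorm (x i - x j) ^+ 2 < c * e ^+ 2 by lra.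
  by rewrite ltr_pM2l// ltr_pXn2r ?nnegrE ?hnorm_ge0 ?ltW.
exists l; first exact: Scl xl.
move=> u Su; apply: le_trans (infle _ Su).
have il : inf (F @` S) + n.+1%:R^-1 @[n --> \oo] --> inf (F @` S).
  rewrite -[X in _ --> X]addr0; apply: cvgD; [exact: cvg_cst|exact: cvg_harmonic].
apply: (ler_cvg_to (Fc _ _ xl) il).
by near=> n; apply/ltW; case: (xP n).
Unshelve. all: by end_near. Qed.

(** The parallelogram identity in midpoint form, which is the shape of the convexity hypothesis of
    [exists_minimizer]. *)
Lemma parallelogram u v :
  hnorm u ^+ 2 + hnorm v ^+ 2 - 2 * hnorm (of_real 2^-1 *: (u + v)) ^+ 2 =
  hnorm (u - v) ^+ 2 / 2.
Proof. by rewrite -!rinnervv !rinnerE (rinnerC v u); field. Qed.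

Lemma midpointB u v w :
  of_real 2^-1 *: (u + v) - w = of_real 2^-1 *: ((u - w) + (v - w)).
Proof.
rewrite addrACA -opprD scalerBr; congr (_ - _).
rewrite -[X in _ *: (X + X)]scale1r -scalerDl scalerA -[LHS]scale1r; congr (_ *: _).
rewrite -[1](_ : of_real 1 = _) -?of_realD -?of_realM; first by congr of_real; field.
by case: (k).
Qed.

Definition rperp A : set U := [set u | forall v, A v -> rinner u v = 0].

Lemma rperp_closed A x l : (forall n, rperp A (x n)) -> hcvg x l -> rperp A l.
Proof.
move=> xA xl v Av; have := @hcvg_rinner x l v xl.
under eq_fun do rewrite (xA _ _ Av).
by move/(cvg_lim (@norm_hausdorff _ _)) => <-; rewrite lim_cst//; apply: norm_hausdorff.
Qed.

Lemma rperp_lin A (a : R) u v : rperp A u -> rperp A v -> rperp A (of_real a *: u + v).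
Proof. by move=> uA vA y Ay; rewrite rinnerPl uA// vA// mulr0 addr0. Qed.

Lemma rperp0 A : rperp A 0.
Proof. by move=> v _; rewrite rinner0l. Qed.

Lemma rperpZ A (a : R) u : rperp A u -> rperp A (of_real a *: u).
Proof. by move=> uA; rewrite -[_ *: _]addr0; apply: rperp_lin => //; exact: rperp0. Qed.

Lemma rperpD A u v : rperp A u -> rperp A v -> rperp A (u + v).
Proof. by move=> uA vA y Ay; rewrite rinnerDl uA// vA// addr0. Qed.

Lemma rperpB A u v : rperp A u -> rperp A v -> rperp A (u - v).
Proof. by move=> uA vA y Ay; rewrite rinnerBl uA// vA// subr0. Qed.

(** [p] is the point of [rperp A] nearest to [u]; the first-order condition along each [h] in
    [rperp A] is the orthogonality of [u - p] to [h]. *)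
Lemma rperp_decomposition A u : exists2 p, rperp A p & rperp (rperp A) (u - p).
Proof.
pose F v := hnorm (v - u) ^+ 2.
have [|||||||p pA pmin] := @exists_minimizer (rperp A) F 0 2^-1.
- by exists 0; exact: rperp0.
- exact: rperp_closed.
- by move=> x y xA yA; apply/rperpZ/rperpD.
- move=> x l xl.
  have h : hnorm (x n - u) @[n --> \oo] --> hnorm (l - u).
    apply: (@hcvg_hnorm (fun n => x n - u)); rewrite /hcvg.
    by under eq_fun do rewrite opprB addrA subrK.
  by apply: cvgM.
- by move=> v; exact: sqr_ge0.
- by rewrite invr_gt0.
- move=> x y xA yA; rewrite /F midpointB parallelogram.
  by rewrite opprB addrA subrK mulrC.
exists p => // h hA; apply: (@linear_coef_eq0 (hnorm h ^+ 2)) => t.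
have := pmin (of_real (- t) *: h + p) (rperp_lin _ hA pA).
by rewrite /F -!rinnervv !rinnerE (rinnerC p h) (rinnerC u h) (rinnerC u p); lra.
Qed.

End Minimization.

(** * Adjoint, kernel, reduced minimum modulus and least squares solutions *)

Section OperatorTheory.
Variables (R : realType) (k : scalar_kind) (U V : hilbertType R k).
Variable Q : {linear U -> V}.
Hypothesis hQ : bounded_operator Q.

Lemma le_opnorm u : hnorm (Q u) <= opnorm Q * hnorm u.
Proof.
have [M QM] := hQ.
have [u0|un0] := eqVneq (hnorm u) 0.
  by rewrite (hnorm_eq0 u0) linear0 !hnorm0 mulr0.
have up : 0 < hnorm u by rewrite lt_def un0 hnorm_ge0.
have : hnorm (Q (of_real (hnorm u)^-1 *: u)) <= opnorm Q.
  apply: ub_le_sup.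
    exists `|M| => _ [x /= x1 <-]; apply: le_trans (QM x) _.
    apply: le_trans (_ : `|M| * hnorm x <= _).
      by rewrite ler_wpM2r ?hnorm_ge0 ?ler_norm.
    by rewrite ler_piMr.
  exists (of_real (hnorm u)^-1 *: u) => //=.
  by rewrite hnormZ gtr0_norm ?invr_gt0// mulVf.
by rewrite (linearZ_LR Q) hnormZ gtr0_norm ?invr_gt0// mulrC ler_pdivrMr.
Qed.

Lemma hcvg_bounded x l : hcvg x l -> hcvg (fun n => Q (x n)) (Q l).
Proof.
move=> xl; apply: (@squeeze_cvgr _ _ _ R (fun=> 0) (fun n => opnorm Q * hnorm (x n - l))).
- by near=> n; rewrite hnorm_ge0 -(linearB Q) le_opnorm.
- exact: cvg_cst.
- by rewrite -(mulr0 (opnorm Q)); apply: cvgMr.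
Unshelve. all: by end_near. Qed.

(** Riesz representation: the first-order condition for a minimizer of |u|^2 - 2 Re <Qu, v> says
    that it represents u -> Re <Qu, v>. *)
Lemma exists_adjoint v : exists a, forall u, rinner (Q u) v = rinner u a.
Proof.
pose F u := hnorm u ^+ 2 - 2 * rinner (Q u) v.
(* The lower bound comes from completing the square in |u|^2 - 2 ||Q|| |u| |v|. *)
pose m := - (opnorm Q * hnorm v) ^+ 2.
have [|||||||p _ pmin] := @exists_minimizer _ _ _ setT F m 2^-1.
- by exists 0.
- by [].
- by [].
- move=> x l xl; apply: cvgB; first by apply: cvgM; exact: hcvg_hnorm.
  by apply: cvgMr; apply: (@hcvg_rinner _ _ _ (fun n => Q (x n))); exact: hcvg_bounded.
- move=> u; have := ler_rinner (Q u) v; have := le_opnorm u.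
  have := hnorm_ge0 v; have := hnorm_ge0 u; have := ler_norm (rinner (Q u) v).
  rewrite /F /m; set a := hnorm u; set b := hnorm v; set r := rinner _ _; set n := opnorm Q.
  move=> h1 h2 h3 h4 h5.
  have : hnorm (Q u) * b <= n * a * b by rewrite ler_wpM2r.
  have := sqr_ge0 (a - n * b); rewrite sqrrB; lra.
- by rewrite invr_gt0.
- move=> x y _ _; rewrite mulrC -parallelogram /F (linearZ_LR Q) (linearD Q).
  by rewrite !rinnerE; lra.
exists p => h; apply/esym/subr0_eq/(@linear_coef_eq0 _ (hnorm h ^+ 2)) => t.
have := pmin (of_real t *: h + p) I.
by rewrite /F (linearD Q) (linearZ_LR Q) -!rinnervv !rinnerE (rinnerC p h); lra.
Qed.

(** The choice in [adjoint] does not fall back on its default 0: the real identity of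
    [exists_adjoint], used at all multiples [c *: u], gives the one for [inner]. *)
Lemma inner_adjoint v u : inner (Q u) v = inner u (adjoint Q v).
Proof.
rewrite /adjoint; move: u.
apply: (@xgetPex _ 0 [set a | forall u, inner (Q u) v = inner u a]).
have [a aP] := exists_adjoint v; exists a => /= u.
apply/subr0_eq/sreM_eq0 => c.
rewrite mulrBr sreB -!innerZl -(linearZ_LR Q).
by apply/eqP; rewrite subr_eq0; apply/eqP; exact: aP.
Qed.

Lemma rinner_adjoint v u : rinner (Q u) v = rinner u (adjoint Q v).
Proof. by rewrite /rinner inner_adjoint. Qed.

Local Notation N := (Defs.kernel Q).

(** Puts the kernel in the form to which [rperp_decomposition] applies. For the converse inclusion,
    test [u] against [adjoint Q (Q u)]. *)
Lemma kernelE : N = rperp (range (adjoint Q)).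
Proof.
apply/seteqP; split=> u /= => [Qu _ [v _ <-]|uP].
  by rewrite -rinner_adjoint Qu rinner0l.
by apply/hnorm_eq0/eqP; rewrite -sqrf_eq0 -rinnervv rinner_adjoint uP.
Qed.

Lemma kernel_decomposition u : exists2 p, Q p = 0 & rperp N (u - p).
Proof.
have [p pN upN] := rperp_decomposition (range (adjoint Q)) u.
by move: pN upN; rewrite -kernelE => pN upN; exists p.
Qed.

Lemma adjoint_rperp v : rperp N (adjoint Q v).
Proof. by move=> u Qu; rewrite rinnerC -rinner_adjoint Qu rinner0l. Qed.

Lemma orthocomplement_kernel : orthocomplement N = rperp N.
Proof.
apply/seteqP; split=> u /= uP v Nv; first by rewrite /rinner uP// -of_real0 sre_real.
rewrite innerC (@inner_eq0 _ _ _ v u) ?sconj0// => c.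
by rewrite rinnerC uP//= /Defs.kernel /= (linearZ_LR Q) Nv scaler0.
Qed.

Lemma ge_reduced_min_modulus x : rperp N x -> x <> 0 ->
  (reduced_min_modulus Q <= (hnorm (Q x) / hnorm x)%:E)%E.
Proof.
move=> xN x0; have nx : 0 < hnorm x.
  by rewrite lt_def hnorm_ge0 andbT; apply/eqP => /hnorm_eq0.
apply: ereal_inf_lbound; exists (of_real (hnorm x)^-1 *: x).
  rewrite /= orthocomplement_kernel; split; first exact: rperpZ.
  by rewrite hnormZ gtr0_norm ?invr_gt0// mulVf ?gt_eqF.
by rewrite (linearZ_LR Q) hnormZ gtr0_norm ?invr_gt0// mulrC.
Qed.

Hypothesis hgamma : (0 < reduced_min_modulus Q)%E.
Local Notation gamma := (fine (reduced_min_modulus Q)).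

Lemma le_reduced_min_modulus x : rperp N x -> gamma * hnorm x <= hnorm (Q x).
Proof.
move=> xN; have [->|/eqP x0] := eqVneq x 0; first by rewrite hnorm0 mulr0 hnorm_ge0.
have nx : 0 < hnorm x.
  by rewrite lt_def hnorm_ge0 andbT; apply/eqP => /hnorm_eq0.
rewrite -ler_pdivlMr// -lee_fin; move: (ge_reduced_min_modulus xN x0).
by move: hgamma; case: reduced_min_modulus.
Qed.

(** A nonzero [x] orthogonal to the kernel makes the modulus finite, so [fine] preserves its
    positivity; |Qx| then lies between gamma |x| and ||Q|| |x|. *)
Lemma reduced_min_modulus_bounds x : rperp N x -> x <> 0 -> 0 < gamma <= opnorm Q.
Proof.
move=> xN x0; apply/andP; split.
  move: (ge_reduced_min_modulus xN x0) hgamma.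
  by case: reduced_min_modulus => //= r _; rewrite lte_fin.
have nx : 0 < hnorm x.
  by rewrite lt_def hnorm_ge0 andbT; apply/eqP => /hnorm_eq0.
rewrite -(ler_pM2r nx); apply: le_trans (le_opnorm x).
exact: le_reduced_min_modulus.
Qed.

(* When [rperp N] is trivial the reduced minimum modulus is [+oo], hence the
   constant [c] that replaces it here. *)
Lemma bounded_below_rperp_kernel :
  exists2 c : R, 0 < c & forall x, rperp N x -> c * hnorm x <= hnorm (Q x).
Proof.
have [[x [xN x0]]|triv] := pselect (exists x, rperp N x /\ x <> 0).
  exists gamma; last exact: le_reduced_min_modulus.
  by case/andP: (reduced_min_modulus_bounds xN x0).
exists 1 => // x xN; have [->|/eqP x0] := eqVneq x 0; last by case: triv; exists x.
by rewrite hnorm0 mulr0 hnorm_ge0.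
Qed.

(** The residual is minimized over [rperp N] only: there [Q] is bounded below by [c], which makes
    its square uniformly convex with constant c^2 / 2. *)
Lemma least_squares_exists (w : V) :
  exists p, forall u, hnorm (Q p - w) <= hnorm (Q u - w).
Proof.
have [c c0 Qc] := bounded_below_rperp_kernel.
pose F u := hnorm (Q u - w) ^+ 2.
have [|||||||p _ pmin] := @exists_minimizer _ _ _ (rperp N) F 0 (c ^+ 2 / 2).
- by exists 0; exact: rperp0.
- exact: rperp_closed.
- by move=> x y xN yN; apply/rperpZ/rperpD.
- move=> x l xl.
  have h : hnorm (Q (x n) - w) @[n --> \oo] --> hnorm (Q l - w).
    apply: (@hcvg_hnorm _ _ _ (fun n => Q (x n) - w)); rewrite /hcvg.
    under eq_fun do rewrite opprB addrA subrK.
    exact: hcvg_bounded.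
  by apply: cvgM.
- by move=> u; exact: sqr_ge0.
- by rewrite divr_gt0 ?exprn_gt0.
- move=> x y xN yN; rewrite /F (linearZ_LR Q) (linearD Q) midpointB parallelogram.
  rewrite opprB addrA subrK -(linearB Q) mulrAC ler_pM2r ?invr_gt0//.
  rewrite -exprMn ler_pXn2r ?nnegrE ?hnorm_ge0 ?mulr_ge0 ?hnorm_ge0 ?(ltW c0)//.
  by apply: Qc; apply: rperpB.
(* Removing the kernel part [q] of [u] leaves the residual unchanged, so the minimum is global. *)
exists p => u; have [q Qq uqN] := kernel_decomposition u.
have := pmin _ uqN; rewrite /F (linearB Q) Qq subr0.
by rewrite ler_pXn2r ?nnegrE ?hnorm_ge0.
Qed.

Lemma least_squaresP (w : V) u : least_squares_solutions Q w u <->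
  forall v, hnorm (Q u - w) <= hnorm (Q v - w).
Proof.
have lbd u' v : lbound [set hnorm (Q v - w) | v in setT] 0.
  by move=> _ [x _ <-]; exact: hnorm_ge0.
rewrite /least_squares_solutions /=; split=> [-> v|umin].
  by apply: ge_inf; [exists 0; exact: lbd|exists v].
apply/le_anti/andP; split.
  by apply: lb_le_inf; [exists (hnorm (Q u - w)), u|move=> _ [v _ <-]].
by apply: ge_inf; [exists 0; exact: lbd|exists u].
Qed.

(** Minimality is tested along u + t h with [h] the vector to be shown zero; the linear coefficient
    is then |h|^2. *)
Lemma normal_equation (w : V) u : least_squares_solutions Q w u ->
  adjoint Q (Q u - w) = 0.
Proof.
move=> /least_squaresP umin; apply/hnorm_eq0/eqP.
rewrite -sqrf_eq0 -rinnervv -rinner_adjoint; set h := adjoint _ _.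
apply/eqP/(@linear_coef_eq0 _ (hnorm (Q h) ^+ 2)) => t.
have := umin (of_real t *: h + u).
rewrite -(@ler_pXn2r _ 2) ?nnegrE ?hnorm_ge0// (linearD Q) (linearZ_LR Q) -addrA.
by rewrite -!rinnervv !rinnerE (rinnerC w (Q h)) (rinnerC (Q u) (Q h)); lra.
Qed.

(** The solution set is a coset of the kernel. Pairing [v - p] with the difference of two normal
    equations gives |Q(v - p)|^2 = 0. *)
Lemma least_squares_kernel (w : V) p v : least_squares_solutions Q w p ->
  least_squares_solutions Q w v <-> Q (v - p) = 0.
Proof.
move=> pM; split=> [vM|Qvp].
  apply/hnorm_eq0/eqP; rewrite -sqrf_eq0 -rinnervv.
  have {2}-> : Q (v - p) = (Q v - w) - (Q p - w) by rewrite (linearB Q) opprB addrA subrK.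
  by rewrite rinnerBr !rinner_adjoint !normal_equation// !rinner0r subrr.
apply/least_squaresP; have <- : Q p = Q v.
  by apply/eqP; rewrite eq_sym -subr_eq0 -(linearB Q) Qvp.
exact/least_squaresP.
Qed.

Lemma orthoproj_least_squares (w : V) x (p := orthoproj (least_squares_solutions Q w) x) :
  least_squares_solutions Q w p /\ rperp N (x - p).
Proof.
set M := least_squares_solutions Q w in p *.
have [pM pP] : M p /\ forall v, M v -> inner (x - p) (v - p) = 0.
  have [q /least_squaresP qM] := least_squares_exists w.
  have [h Qh xqh] := kernel_decomposition (x - q).
  apply: (@xgetPex _ 0 [set p | M p /\ forall v, M v -> inner (x - p) (v - p) = 0]).
  have qhM : M (q + h) by apply/(least_squares_kernel _ qM); rewrite addrAC subrr add0r.
  (* Since [h] is the kernel part of [x - q], the point [q + h] stays in the coset and [x - (q + h)]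
     is orthogonal to the kernel. *)
  exists (q + h); split=> // v /(least_squares_kernel _ qhM) vN.
  by move: xqh; rewrite -addrA -opprD -orthocomplement_kernel => ->.
split=> // v Qv; have vpM : M (v + p).
  by apply/(least_squares_kernel _ pM); rewrite addrK.
by have := pP _ vpM; rewrite addrK /rinner => ->; rewrite -of_real0 sre_real.
Qed.

End OperatorTheory.

(** * Contraction of one iteration step on the orthogonal complement of the kernel *)

Section Contraction.
Variables (R : realType) (k : scalar_kind) (U V : hilbertType R k).
Variable Q : {linear U -> V}.
Hypothesis hQ : bounded_operator Q.
Hypothesis hgamma : (0 < reduced_min_modulus Q)%E.
Local Notation N := (Defs.kernel Q).
Local Notation gamma := (fine (reduced_min_modulus Q)).
Local Notation kappa := (opnorm Q / gamma).

Lemma rinner_ext (a b : U) : (forall u, rinner u a = rinner u b) -> a = b.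
Proof.
move=> ab; apply/subr0_eq/hnorm_eq0/eqP.
by rewrite -sqrf_eq0 -rinnervv rinnerBr ab subrr.
Qed.

Lemma adjointD v w : adjoint Q (v + w) = adjoint Q v + adjoint Q w.
Proof.
by apply: rinner_ext => u; rewrite rinnerDr -!(rinner_adjoint hQ) rinnerDr.
Qed.

Lemma landweber_rperp (a : R) x : rperp N x ->
  rperp N (x - of_real a *: adjoint Q (Q x)).
Proof. by move=> xN; apply: rperpB => //; apply: rperpZ; exact: adjoint_rperp. Qed.

(* The norm of a symmetric operator [B] is the supremum of its quadratic form:
   polarize [rinner (B x) y] at [y] proportional to [B x]. *)
Lemma landweber_le_form (a c : R) x :
  (forall z, rperp N z -> `|hnorm z ^+ 2 - a * hnorm (Q z) ^+ 2| <= c * hnorm z ^+ 2) ->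
  rperp N x -> hnorm (x - of_real a *: adjoint Q (Q x)) <= c * hnorm x.
Proof.
move=> form xN; have yN := landweber_rperp a xN.
move: yN; set y := x - _ => yN.
have yE : rinner x y - a * rinner (Q x) (Q y) = hnorm y ^+ 2.
  rewrite -(rinnervv y) {3}/y rinnerBl rinnerZl (rinnerC (adjoint _ _)).
  by rewrite -rinner_adjoint// (rinnerC (Q y)).
move: y yN yE => y yN yE.
have [x0|x0] := eqVneq x 0.
  rewrite x0 hnorm0 mulr0; move: yE.
  by rewrite x0 linear0 !rinner0l mulr0 subr0 => /esym/eqP; rewrite sqrf_eq0 => /eqP ->.
have X0 : 0 < hnorm x.
  by rewrite lt_def hnorm_ge0 andbT; apply: contra_neq x0 => /hnorm_eq0.
have [y0|Y0] := eqVneq (hnorm y) 0.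
  have := le_trans (normr_ge0 _) (form x xN).
  by rewrite y0 pmulr_lge0 ?exprn_gt0// => c0; rewrite mulr_ge0// ltW.
have {}Y0 : 0 < hnorm y by rewrite lt_def Y0 hnorm_ge0.
(* The form is evaluated at |y| x + |x| y and |y| x - |x| y. The difference of the values is 4 |x|
   |y|^3, and the two bounds add up to 4 c |x|^2 |y|^2. *)
have h1 := le_trans (ler_norm _) (form _ (rperp_lin (hnorm y) xN (rperpZ (hnorm x) yN))).
have h2 := form _ (rperp_lin (hnorm y) xN (rperpZ (- hnorm x) yN)).
move: h2; rewrite ler_norml => /andP[h2 _]; move: h1 h2.
rewrite !(linearD Q) !(linearZ_LR Q) -!(rinnervv (_ + _)) !rinnerE !rinnervv.
rewrite (rinnerC y x) (rinnerC (Q y)).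
set X := hnorm x in X0 *; set Y := hnorm y in Y0 yE *.
set r := rinner x y in yE *; set r' := rinner (Q x) (Q y) in yE *.
move=> h1 h2.
have : X * Y * Y ^+ 2 <= X * Y * (c * X * Y) by rewrite -yE; lra.
by rewrite ler_pM2l ?mulr_gt0// expr2 ler_pM2r.
Qed.

(** The form lies between (1 - 2 lambda) |z|^2 and (1 - 2 lambda / kappa^2) |z|^2. With m the
    minimum, m <= lambda handles the upper end; m <= 1 - lambda and kappa >= 1 handle the lower. *)
Lemma landweber_contraction (a : R) x (lambda := a * opnorm Q ^+ 2 / 2) :
  0 <= lambda <= 1 -> rperp N x ->
  hnorm (x - of_real a *: adjoint Q (Q x)) <=
    (1 - 2 * Num.min lambda (1 - lambda) / kappa ^+ 2) * hnorm x.
Proof.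
move=> /andP[l0 l1] xN; apply: landweber_le_form => // z zN.
have [->|/eqP z0] := eqVneq z 0.
  by rewrite linear0 !hnorm0 expr0n /= !mulr0 subr0 normr0.
have /andP[g0 gn] := reduced_min_modulus_bounds hQ hgamma zN z0.
have n0 := lt_le_trans g0 gn.
have Qz1 : hnorm (Q z) ^+ 2 <= opnorm Q ^+ 2 * hnorm z ^+ 2.
  rewrite -exprMn ler_pXn2r ?nnegrE ?mulr_ge0 ?hnorm_ge0 ?(ltW n0)//.
  exact: le_opnorm.
have Qz2 : gamma ^+ 2 * hnorm z ^+ 2 <= hnorm (Q z) ^+ 2.
  rewrite -exprMn ler_pXn2r ?nnegrE ?mulr_ge0 ?hnorm_ge0 ?(ltW g0)//.
  exact: le_reduced_min_modulus.
have n20 : 0 < opnorm Q ^+ 2 by rewrite exprn_gt0.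
have aE : a = 2 * lambda / opnorm Q ^+ 2 by rewrite /lambda; field; rewrite gt_eqF.
have a0 : 0 <= a by rewrite aE mulr_ge0 ?invr_ge0 ?(ltW n20)// mulr_ge0.
have ag : a * gamma ^+ 2 = 2 * lambda / kappa ^+ 2.
  by rewrite aE; field; rewrite !gt_eqF.
have an : a * opnorm Q ^+ 2 = 2 * lambda by rewrite aE; field; rewrite gt_eqF.
have s0 : 0 < (kappa ^+ 2)^-1 by rewrite invr_gt0 exprn_gt0// divr_gt0.
have s1 : (kappa ^+ 2)^-1 <= 1.
  by rewrite invf_le1 ?exprn_gt0 ?divr_gt0// exprn_ege1// ler_pdivlMr// mul1r.
have := ler_wpM2l a0 Qz1; rewrite (mulrA a (opnorm Q ^+ 2)) an.
have := ler_wpM2l a0 Qz2; rewrite (mulrA a (gamma ^+ 2)) ag.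
have m0 : 0 <= Num.min lambda (1 - lambda) by rewrite le_min l0 subr_ge0.
have : Num.min lambda (1 - lambda) <= lambda by rewrite ge_min lexx.
have : Num.min lambda (1 - lambda) <= 1 - lambda by rewrite ge_min lexx orbT.
have := sqr_ge0 (hnorm z); move: s0 s1 m0.
set s := (kappa ^+ 2)^-1; set m := Num.min _ _; set Z := hnorm z ^+ 2.
set D := hnorm (Q z) ^+ 2 => s0 s1 m0 Z0 m1 m2 h1 h2.
have sm : m * s <= m by rewrite ler_piMr.
have slm : m * s <= lambda * s by rewrite ler_wpM2r// ltW.
have k1 : 2 * lambda * Z <= (2 - 2 * (m * s)) * Z by rewrite ler_wpM2r//; lra.
have k2 : 2 * (m * s) * Z <= 2 * (lambda * s) * Z by rewrite ler_wpM2r//; lra.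
by rewrite ler_norml; apply/andP; split; lra.
Qed.

End Contraction.

(** * From a positive lower mean to geometric decay *)

Section Rates.
Variable R : realType.

(** If every tail infimum were at most 0, so would be their limit. A positive tail infimum is
    finite, being below a term of the sequence, and serves as [d]. *)
Lemma limn_einf_gt0 (v : nat -> R) : (0 < limn_einf (fun n => (v n)%:E))%E ->
  exists2 d : R, 0 < d & exists M, forall n, (M <= n)%N -> d <= v n.
Proof.
rewrite limn_einf_lim => h.
have [M M0] : exists M, (0 < einfs (fun n => (v n)%:E) M)%E.
  apply: contrapT => /forallNP e0; move: h; apply/negP; rewrite -leNgt.
  apply: lime_le; first exact: is_cvg_einfs.
  by near=> n; rewrite leNgt; apply/negP/e0.
have leM n : (M <= n)%N -> (einfs (fun n => (v n)%:E) M <= (v n)%:E)%E.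
  by move=> Mn; apply: ereal_inf_lbound; exists n.
move: M0 leM; case: (einfs _ _) => [d| |] //.
- by rewrite lte_fin => d0 dv; exists d => //; exists M => n /dv; rewrite lee_fin.
- by move=> _ /(_ M (leqnn _)).
Unshelve. all: by end_near. Qed.

(** Iterating 1 - t <= exp(-t) bounds x_n by exp(-c S_n) x_0 with S_n the partial sum of [m], and
    S_n >= d n from some index [M] on. *)
Lemma exp_decay_linear (x m : nat -> R) (c : R) :
  0 < c -> (forall n, 0 <= x n) -> (forall n, 0 <= m n) ->
  (forall n, x n.+1 <= (1 - c * m n) * x n) ->
  (0 < limn_einf (fun n => (n%:R^-1 * \sum_(0 <= j < n) m j)%:E))%E ->
  exists C q : R, [/\ 0 <= C, 0 < q, q < 1 & forall n, x n <= C * q ^+ n].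
Proof.
move=> c0 x0 m0 xS /limn_einf_gt0[d d0 [M dM]].
have xexp n : x n <= expR (- c * \sum_(0 <= j < n) m j) * x 0%N.
  elim: n => [|n IH]; first by rewrite big_geq// mulr0 expR0 mul1r.
  apply: le_trans (xS n) _.
  rewrite big_nat_recr//= mulrDr [X in expR X]addrC expRD -mulrA.
  apply: le_trans (_ : expR (- c * m n) * x n <= _); last by rewrite ler_wpM2l ?expR_ge0.
  by rewrite ler_wpM2r// mulNr expR_ge1Dx.
pose q := expR (- c * d).
have q0 : 0 < q := expR_gt0 _.
have q1 : q < 1 by rewrite /q mulNr expR_lt1 oppr_lt0 mulr_gt0.
(* The factor [q ^- M] absorbs the indices below [M], where the means are not controlled: there the
   exponential is at most 1 <= q^(n - M). *)
exists (x 0%N * q ^- M), q; split=> //.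
  by rewrite mulr_ge0 ?invr_ge0 ?exprn_ge0// ltW.
move=> n; apply: le_trans (xexp n) _.
rewrite mulrC -mulrA ler_wpM2l//.
have qM : 1 <= q ^- M by rewrite invf_ge1 ?exprn_gt0// exprn_ile1// ltW.
have [nM|Mn] := ltnP n M.
  apply: le_trans (_ : 1 <= _).
    by rewrite mulNr -[leRHS]expR0 ler_expR oppr_le0 mulr_ge0 ?sumr_ge0// ltW.
  rewrite mulrC ler_pdivlMr ?exprn_gt0// mul1r.
  exact: (ler_wiXn2l (ltW q0) (ltW q1) (ltnW nM)).
apply: le_trans (_ : q ^+ n <= _); last by rewrite ler_peMl// exprn_ge0 ?ltW.
rewrite /q -expRM_natl ler_expR [leRHS]mulrCA ler_wnM2l ?oppr_le0 ?(ltW c0)//.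
have [->|n0] := posnP n; first by rewrite mul0r big_geq.
by have := dM n Mn; rewrite ler_pdivlMl ?ltr0n.
Qed.

End Rates.

(** * Error recursion and the two convergence rates *)

Theorem theorem4p5 (R : realType) (k : scalar_kind) (U V : hilbertType R k)
    (Q : {linear U -> V}) (hQ : bounded_operator Q)
    (hgamma : (0 < reduced_min_modulus Q)%E)
    (w : V) (alpha : nat -> R) (u : nat -> U)
    (hu : forall n,
      u n.+1 = u n - of_real (alpha n) *: adjoint Q (Q (u n) - w)) :
  let e := fun n => u n - orthoproj (least_squares_solutions Q w) (u 0%N) in
  let lambda := fun n => alpha n * opnorm Q ^+ 2 / 2 in
  let kappa := opnorm Q / fine (reduced_min_modulus Q) in
  ((forall n, 0 <= lambda n <= 1) ->
   (0 < limn_einf (fun n => (n%:R^-1 *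
      \sum_(0 <= j < n) Num.min (lambda j) (1 - lambda j))%:E))%E ->
   converges_linearly_to_zero e)
  /\
  (forall eps : R, 0 < eps <= 1 ->
   (forall n, eps / 2 <= lambda n <= 1 - eps / 2) ->
   forall n, hnorm (e n) <= (1 - eps / kappa ^+ 2) ^+ n * hnorm (e 0%N)).
Proof.
move=> e lambda kappa.
have [pM e0N] := orthoproj_least_squares hQ hgamma w (u 0%N).
have eS n : e n.+1 = e n - of_real (alpha n) *: adjoint Q (Q (e n)).
  rewrite /e hu addrAC; congr (_ - _ *: _).
  (* Here [u n - e n] is the projection, whose residual is annihilated by the adjoint. *)
  have -> : Q (u n) - w = Q (e n) + (Q (u n - e n) - w).
    by rewrite addrA -(linearD Q) [e n + _]addrC subrK.
  by rewrite (adjointD hQ) /e subKr (normal_equation hQ pM) addr0.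
have eN n : rperp (Defs.kernel Q) (e n).
  by elim: n => // n eN; rewrite eS; exact: landweber_rperp.
have contraction n : 0 <= lambda n <= 1 -> hnorm (e n.+1) <=
    (1 - 2 * Num.min (lambda n) (1 - lambda n) / kappa ^+ 2) * hnorm (e n).
  by move=> ln; rewrite eS; exact: landweber_contraction.
(* If [e 0] vanishes, the modulus may be [+oo] and [kappa] a default value, but all errors are zero.
   Otherwise [e 0] itself witnesses that gamma is finite and at most ||Q||. *)
have [e00|/eqP e00] := eqVneq (e 0%N) 0.
  have en0 n : hnorm (e n) = 0.
    elim: n => [|n /hnorm_eq0 en0]; first by rewrite e00 hnorm0.
    rewrite eS en0 linear0 sub0r hnormN hnormZ.
    suff -> : adjoint Q 0 = 0 by rewrite hnorm0 mulr0.
    by apply: (@addrI _ (adjoint Q 0)); rewrite -(adjointD hQ) !addr0.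
  split=> [_ _|eps _ _ n]; last by rewrite !en0 mulr0.
  exists 0, 2^-1; split=> // [|n]; rewrite ?invr_gt0 ?invf_lt1 ?ltr1n//.
  by rewrite en0 mul0r.
have /andP[g0 gn] := reduced_min_modulus_bounds hQ hgamma (e0N) e00.
have kappa1 : 1 <= kappa by rewrite ler_pdivlMr// mul1r.
have kappa20 : 0 < kappa ^+ 2 by rewrite exprn_gt0// (lt_le_trans ltr01).
split=> [lambda01 minf|eps /andP[eps0 eps1] leps n].
  apply: (@exp_decay_linear _ (fun n => hnorm (e n))
    (fun n => Num.min (lambda n) (1 - lambda n)) (2 / kappa ^+ 2)) => //.
  - by rewrite divr_gt0.
  - by move=> n; exact: hnorm_ge0.
  - by move=> n; have /andP[l0 l1] := lambda01 n; rewrite le_min l0 subr_ge0.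
  - by move=> n; have := contraction n (lambda01 n); rewrite mulrAC.
(* Nonnegativity of the rate, from eps <= 1 <= kappa^2, lets the induction hypothesis be multiplied
   by it. *)
have r0 : 0 <= 1 - eps / kappa ^+ 2.
  by rewrite subr_ge0 ler_pdivrMr// mul1r (le_trans eps1)// exprn_ege1.
elim: n => [|n IH]; first by rewrite expr0 mul1r.
have /andP[l1 l2] := leps n.
have ln : 0 <= lambda n <= 1 by apply/andP; split; lra.
apply: le_trans (contraction n ln) _.
rewrite [_ ^+ n.+1]exprS -[leRHS]mulrA; apply: le_trans _ (ler_wpM2l r0 IH).
rewrite ler_wpM2r ?hnorm_ge0// lerD2l lerN2 ler_pM2r ?invr_gt0//.
(* The factor 2 in the contraction rate turns this [eps / 2] into [eps]. *)
have : eps / 2 <= Num.min (lambda n) (1 - lambda n).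
  by rewrite le_min l1; lra.
lra.
Qed.
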